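(* Fix $\Delta\in\{2,3,\dots\}$ and $\beta\in\mathbb{R}$. Let $G$ be a graph of maximum degree at most $\Delta$ with $|V(G)|=n$, and let $h\colon V(G)\to\mathbb{R}$ satisfy $|h_x|\ge h_0(\Delta,\beta):=\Delta|\beta|+\frac12\log\Delta$ for all $x\in V(G)$. Then the mixing time of the Glauber dynamics for the Ising model on $G$ with inverse temperature $\beta$ and external fields $h$ is $O(n\log n)$ (with the implied constant depending only on $\Delta$ and $\beta$).
   Context: The Ising model on $G=(V,E)$ is $p(\sigma)\propto\exp\big(\beta\sum_{xy\in E}\sigma_x\sigma_y+\sum_{x\in V}h_x\sigma_x\big)$ on $\{\pm1\}^V$. The Glauber dynamics is the Markov chain on $\{\pm1\}^V$ which at each step picks a vertex $x\in V$ uniformly at random and resamples $\sigma_x$ from its conditional distribution under the Ising model given the current spins at all other vertices, leaving other spins unchanged. The mixing time is the least number of steps after which the total variation distance to the Ising distribution is at most $1/4$ from every starting configuration. *)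

(* Defs.v *)
From HB Require Import structures.
From mathcomp Require Import all_boot all_order all_algebra.
From mathcomp Require Import all_reals sequences exp.

Set Implicit Arguments.
Unset Strict Implicit.
Unset Printing Implicit Defensive.

Import Order.TTheory GRing.Theory Num.Theory.

Local Open Scope ring_scope.

(* A finite simple graph is a finType [V] of vertices with a symmetric and
   irreflexive adjacency relation [e : rel V]; its edges are unordered pairs. *)
Definition edges (V : finType) (e : rel V) : {set {set V}} :=
  [set [set p.1; p.2] | p : V * V & e p.1 p.2].

Definition degree (V : finType) (e : rel V) (x : V) : nat :=
  #|[set y | e x y]|.

Definition config (V : finType) := {ffun V -> bool}.

Definition spin (R : realType) (b : bool) : R := if b then 1 else -1.

(* For an edge A = {x, y}, the product over A is sigma_x * sigma_y, so the
   first sum runs over unordered edges, each counted once. *)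
Definition ising_weight (R : realType) (V : finType) (e : rel V)
    (beta : R) (h : V -> R) (s : config V) : R :=
  expR (beta * (\sum_(A in edges e) \prod_(x in A) spin R (s x))
        + \sum_(x : V) h x * spin R (s x)).

Definition ising (R : realType) (V : finType) (e : rel V)
    (beta : R) (h : V -> R) (s : config V) : R :=
  ising_weight e beta h s / \sum_(u : config V) ising_weight e beta h u.

Definition agree_off (V : finType) (x : V) (s u : config V) : bool :=
  [forall y, (y != x) ==> (u y == s y)].

(* [resample mu x s] is mu conditioned on the event that the spins at all
   vertices other than x are those of s. *)
Definition resample (R : realType) (V : finType) (mu : config V -> R)
    (x : V) (s u : config V) : R :=
  if agree_off x s u then mu u / \sum_(w | agree_off x s w) mu w else 0.

Definition glauber (R : realType) (V : finType) (mu : config V -> R)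
    (s u : config V) : R :=
  (#|V|%:R)^-1 * \sum_(x : V) resample mu x s u.

(* [law P s t u] is the probability that the chain with transition matrix P
   started at s is at u after t steps. *)
Fixpoint law (R : realType) (S : finType) (P : S -> S -> R) (s : S) (t : nat)
    : S -> R :=
  if t is t'.+1 then fun u => \sum_(w : S) law P s t' w * P w u
  else fun u => (u == s)%:R.

Definition tv_dist (R : realType) (S : finType) (mu nu : S -> R) : R :=
  2^-1 * \sum_(s : S) `|mu s - nu s|.

Definition mixed (R : realType) (S : finType) (P : S -> S -> R) (pi : S -> R)
    (t : nat) : Prop :=
  forall s : S, tv_dist (law P s t) pi <= 4^-1.

Definition is_mixing_time (R : realType) (S : finType) (P : S -> S -> R)
    (pi : S -> R) (t : nat) : Prop :=
  mixed P pi t /\ forall t' : nat, mixed P pi t' -> (t <= t')%N.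

Definition h0 (R : realType) (Delta : nat) (beta : R) : R :=
  Delta%:R * `|beta| + 2^-1 * ln (Delta%:R).

(* Main.v *)
(** Let P be the transition operator of the Glauber dynamics acting on
    functions of configurations, and measure Lipschitz constants in the Hamming
    distance.  Each external field is so strong that, whatever the neighbouring
    spins, the spin opposed to it has conditional probability at most
    1 / (Delta + 1); hence changing neighbours of x moves the conditional law at
    x by at most 1 / (Delta + 1) in total variation.  A disagreement is erased
    with probability 1 / n, and it can spread to at most Delta neighbours, so P
    multiplies Lipschitz constants by at most 1 - 1 / ((Delta + 1) n).  By
    stationarity, and since the Hamming diameter is n, the total variation
    distance after t steps is at most n exp (- t / ((Delta + 1) n)). *)

Require Import Defs.
From mathcomp Require Import all_boot all_order all_algebra.
From mathcomp Require Import all_reals sequences exp.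
From mathcomp Require Import ring lra.

Set Implicit Arguments.
Unset Strict Implicit.
Unset Printing Implicit Defensive.

Import Order.TTheory GRing.Theory Num.Theory.
Local Open Scope ring_scope.

Definition set_spin (V : finType) (x : V) (b : bool) (s : config V) : config V :=
  [ffun y => if y == x then b else s y].

Definition hamming (V : finType) (s u : config V) : nat :=
  #|[set y | s y != u y]|.

Definition lipschitz (R : realType) (V : finType) (L : R)
    (f : config V -> R) : Prop :=
  forall s u, `|f s - f u| <= L * (hamming s u)%:R.

Definition transition_op (R : realType) (S : finType) (P : S -> S -> R)
    (f : S -> R) : S -> R :=
  fun s => \sum_u P s u * f u.

(** The conditional probability of a plus spin at [x] given the spins of [s] elsewhere; being a
    ratio, it does not see the normalisation of [mu]. *)
Definition plus_prob (R : realType) (V : finType) (mu : config V -> R)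
    (x : V) (s : config V) : R :=
  mu (set_spin x true s) / (mu (set_spin x true s) + mu (set_spin x false s)).

(** * Single-site changes and the Hamming distance *)

Section Configurations.
Variable V : finType.
Implicit Types (x y : V) (s u w : config V) (b : bool).

Lemma set_spin_at x b s : set_spin x b s x = b.
Proof. by rewrite ffunE eqxx. Qed.

Lemma set_spin_off x y b s : y != x -> set_spin x b s y = s y.
Proof. by rewrite ffunE => /negPf ->. Qed.

Lemma agree_offP x s u :
  reflect (u = set_spin x (u x) s) (agree_off x s u).
Proof.
apply: (iffP forallP) => [H|-> y].
  apply/ffunP => y; rewrite ffunE; case: eqVneq => [->//|yx].
  by have := H y; rewrite yx => /eqP.
by apply/implyP => yx; rewrite set_spin_off.
Qed.

Lemma agree_off_sym x s u : agree_off x s u = agree_off x u s.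
Proof. by apply: eq_forallb => y; rewrite [s y == _]eq_sym. Qed.

Lemma agree_off_set_spin x b s : agree_off x s (set_spin x b s).
Proof. by apply/agree_offP; rewrite set_spin_at. Qed.

Lemma agree_off_eql x s u : agree_off x s u -> agree_off x s =1 agree_off x u.
Proof.
move=> /forallP H w; apply: eq_forallb => y.
by have := H y; case: (y != x) => //= /eqP ->.
Qed.

Lemma sum_agree_off (R : nmodType) x s (F : config V -> R) :
  \sum_(u | agree_off x s u) F u = F (set_spin x true s) + F (set_spin x false s).
Proof.
rewrite (bigD1 (set_spin x true s)) ?agree_off_set_spin //=.
congr (_ + _); apply: big_pred1 => u /=.
apply/andP/eqP => [[/agree_offP ->]|->].
  by case: (u x); rewrite ?eqxx.
split; first exact: agree_off_set_spin.
by apply/eqP => /ffunP /(_ x); rewrite !set_spin_at.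
Qed.

(** Writing the same spin at [x] in both configurations erases a disagreement there and touches no
    other; the additive form avoids truncated subtraction. *)
Lemma hamming_set_spin x b s u :
  (hamming (set_spin x b s) (set_spin x b u) + (s x != u x) = hamming s u)%N.
Proof.
rewrite /hamming (cardsD1 x [set y | s y != u y]) inE addnC; congr (_ + _)%N.
apply: eq_card => y; rewrite !inE !ffunE.
by case: (y == x); rewrite //= eqxx.
Qed.

Lemma hamming_set_spin_le1 x b b' s :
  (hamming (set_spin x b s) (set_spin x b' s) <= 1)%N.
Proof.
rewrite -(cards1 x); apply/subset_leq_card/subsetP => y.
by rewrite !inE !ffunE; case: (y == x); rewrite ?eqxx.
Qed.

Lemma hamming_gt0 s u : s != u -> (0 < hamming s u)%N.
Proof.
apply: contraNT; rewrite -eqn0Ngt cards_eq0 => /eqP E.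
apply/eqP/ffunP => y; apply/eqP.
by have := in_set0 y; rewrite -E inE => /negbFE.
Qed.

Lemma hamming_sum s u : hamming s u = (\sum_(y : V) (s y != u y))%N.
Proof. by rewrite /hamming -sum1dep_card -big_mkcond. Qed.

(* Double counting of the edges leaving the disagreement set. *)
Lemma sum_disagreeing_neighbours (e : rel V) (D : nat) s u :
  symmetric e -> (forall x, (degree e x <= D)%N) ->
  (\sum_x #|[set y | e x y & s y != u y]| <= D * hamming s u)%N.
Proof.
move=> esym edeg.
have -> : (\sum_x #|[set y | e x y & s y != u y]| =
  \sum_x \sum_y (e x y && (s y != u y)))%N.
  by apply: eq_bigr => x _; rewrite -sum1dep_card -big_mkcond.
rewrite exchange_big /= hamming_sum big_distrr /=; apply: leq_sum => y _.
case: (s y != u y); last by rewrite big1 // => x _; rewrite andbF.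
rewrite muln1; apply: leq_trans (edeg y).
rewrite /degree -sum1dep_card [X in (_ <= X)%N]big_mkcond leq_sum // => x _.
by rewrite andbT esym.
Qed.

End Configurations.

(** * Duality between laws and the transition operator *)

Section Markov.
Variables (R : realType) (S : finType) (P : S -> S -> R).

(** The last step of [law] is absorbed into the test function, so the induction must let [f]
    vary. *)
Lemma sum_law s t (f : S -> R) :
  \sum_u law P s t u * f u = iter t (transition_op P) f s.
Proof.
elim: t f => [|t IH] f.
  rewrite /= (bigD1 s) //= eqxx mul1r big1 ?addr0 // => u /negPf ->.
  by rewrite mul0r.
rewrite iterSr -IH /=.
under eq_bigr do rewrite big_distrl /=.
rewrite exchange_big /=; apply: eq_bigr => w _.
by rewrite /transition_op big_distrr; apply: eq_bigr => u _; rewrite /= mulrA.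
Qed.

Lemma sum_stationary (pi : S -> R) t (f : S -> R) :
  (forall u, \sum_w pi w * P w u = pi u) ->
  \sum_w pi w * iter t (transition_op P) f w = \sum_w pi w * f w.
Proof.
move=> stat; elim: t => //= t <-; rewrite /transition_op.
under eq_bigr do rewrite big_distrr /=.
rewrite exchange_big /=; apply: eq_bigr => u _.
by rewrite -[in RHS]stat big_distrl; apply: eq_bigr => w _; rewrite /= mulrA.
Qed.

End Markov.

(** * Stationarity and contraction of the Glauber dynamics *)

Section Glauber.
Variables (R : realType) (V : finType) (mu : config V -> R).
Hypothesis mu_gt0 : forall s, 0 < mu s.

(** Each single-site update already preserves [mu]: all configurations agreeing with [u] off [x]
    share one normaliser, and their total weight cancels it. *)
Lemma glauber_stationary u : (0 < #|V|)%N -> \sum_w mu w * glauber mu w u = mu u.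
Proof.
move=> V0; rewrite /glauber.
under eq_bigr do rewrite mulrCA big_distrr /=.
rewrite -big_distrr exchange_big /=.
rewrite (eq_bigr (fun=> mu u)) => [|x _].
  by rewrite sumr_const -[mu u *+ _]mulr_natl mulKf // pnatr_eq0 -lt0n.
rewrite /resample.
have Z0 : \sum_(w | agree_off x u w) mu w != 0.
  by rewrite sum_agree_off gt_eqF // addr_gt0.
rewrite -[RHS](mulVKf Z0) [in RHS]big_distrl [RHS]big_mkcond.
apply: eq_bigr => w _ /=.
rewrite agree_off_sym; case: ifPn => [ag|_]; last by rewrite mulr0.
by rewrite [_^-1 * _]mulrC (eq_bigl _ _ (agree_off_eql ag)).
Qed.

Lemma plus_prob_itv x s : 0 <= plus_prob mu x s <= 1.
Proof.
have := mu_gt0 (set_spin x true s); have := mu_gt0 (set_spin x false s).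
rewrite /plus_prob; move: (mu _) (mu _) => a b a0 b0.
apply/andP; split; first by rewrite divr_ge0 ?addr_ge0 ?ltW.
by rewrite ler_pdivrMr ?addr_gt0 // mul1r lerDl ltW.
Qed.

Lemma resample_op x s (f : config V -> R) :
  transition_op (resample mu x) f s =
  plus_prob mu x s * f (set_spin x true s)
  + (1 - plus_prob mu x s) * f (set_spin x false s).
Proof.
rewrite /transition_op /resample.
under eq_bigr do rewrite (fun_if ( *%R^~ _)) mul0r.
rewrite -big_mkcond /= !sum_agree_off /plus_prob.
have := mu_gt0 (set_spin x true s); have := mu_gt0 (set_spin x false s).
move: (mu _) (mu _) => a b a0 b0; field.
by rewrite gt_eqF // addr_gt0.
Qed.

Lemma glauber_op s (f : config V -> R) :
  transition_op (glauber mu) f s =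
  #|V|%:R^-1 * \sum_x transition_op (resample mu x) f s.
Proof.
rewrite /transition_op /glauber.
under eq_bigr do rewrite -mulrA big_distrl /=.
by rewrite -big_distrr exchange_big.
Qed.

Lemma resample_op_lipschitz L x s u (f : config V -> R) : 0 <= L -> lipschitz L f ->
  `|transition_op (resample mu x) f s - transition_op (resample mu x) f u| <=
  L * ((hamming s u)%:R - (s x != u x)%:R
       + `|plus_prob mu x s - plus_prob mu x u|).
Proof.
move=> L0 fL; rewrite !resample_op.
have /andP[p0 p1] := plus_prob_itv x s.
have Hd b : `|f (set_spin x b s) - f (set_spin x b u)| <=
    L * ((hamming s u)%:R - (s x != u x)%:R).
  by rewrite -(hamming_set_spin x b s u) natrD addrK; apply: fL.
have Hf : `|f (set_spin x true u) - f (set_spin x false u)| <= L.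
  apply: le_trans (fL _ _) _.
  by rewrite -[leRHS]mulr1 ler_wpM2l // (ler_nat _ _ 1) hamming_set_spin_le1.
move: (plus_prob mu x s) (plus_prob mu x u) p0 p1 => p q p0 p1.
have := Hd true; have := Hd false; move: Hf.
move: (f (set_spin x true u)) (f (set_spin x false u)) => a b.
move: (f (set_spin x true s)) (f (set_spin x false s)) => c d Hf Hb Ha.
move: (_%:R - _%:R) Ha Hb => D Ha Hb.
(* The first two terms give both configurations the same new spin at [x]; the third pays for the
   change in the law of that spin, against a one-site variation of [f]. *)
have -> : p * c + (1 - p) * d - (q * a + (1 - q) * b) =
  p * (c - a) + (1 - p) * (d - b) + (p - q) * (a - b) by ring.
apply: le_trans (ler_normD _ _) _; rewrite [leRHS]mulrDr; apply: lerD.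
  apply: le_trans (ler_normD _ _) _; rewrite !normrM (ger0_norm p0).
  rewrite (@ger0_norm _ (1 - p)) ?subr_ge0 //.
  have -> : L * D = p * (L * D) + (1 - p) * (L * D) by ring.
  by apply: lerD; apply: ler_wpM2l; rewrite ?subr_ge0.
by rewrite normrM mulrC; apply: ler_wpM2r.
Qed.

(** Summed over [x], the erased disagreements total one Hamming distance, while the newly created
    ones total at most [k * D] Hamming distances by double counting. *)
Lemma glauber_op_lipschitz (e : rel V) (D : nat) (k L : R) (f : config V -> R) :
  symmetric e -> (forall x, (degree e x <= D)%N) -> 0 <= k -> 0 <= L ->
  (0 < #|V|)%N ->
  (forall x s u, `|plus_prob mu x s - plus_prob mu x u| <=
                 k * #|[set y | e x y & s y != u y]|%:R) ->
  lipschitz L f ->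
  lipschitz (L * (1 - (1 - k * D%:R) / #|V|%:R)) (transition_op (glauber mu) f).
Proof.
move=> esym edeg k0 L0 V0 Hp fL s u.
rewrite !glauber_op -mulrBr -sumrB normrM ger0_norm ?invr_ge0 //.
have n0 : 0 < #|V|%:R :> R by rewrite ltr0n.
rewrite mulrC ler_pdivrMr //.
apply: le_trans (ler_norm_sum _ _ _) _.
apply: le_trans (ler_sum _ (fun x _ => resample_op_lipschitz x s u L0 fL)) _.
rewrite -big_distrr /= -!mulrA; apply: ler_wpM2l => //.
rewrite big_split sumrB /= sumr_const -[_ *+ #|_|]mulr_natl -natr_sum -hamming_sum.
have -> : (1 - (1 - k * D%:R) / #|V|%:R) * ((hamming s u)%:R * #|V|%:R) =
  #|V|%:R * (hamming s u)%:R - (hamming s u)%:R + k * (D%:R * (hamming s u)%:R).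
  by field; rewrite gt_eqF.
rewrite lerD2l; apply: le_trans (ler_sum _ (fun x _ => Hp x s u)) _.
rewrite -big_distrr /= ler_wpM2l // -natr_sum -natrM ler_nat.
exact: sum_disagreeing_neighbours.
Qed.

(* Testing [law - mu] against its sign function, which is 2-Lipschitz. *)
Lemma glauber_tv (rho : R) (s : config V) (t : nat) :
  \sum_u mu u = 1 -> (0 < #|V|)%N -> 0 <= rho ->
  (forall L f, 0 <= L -> lipschitz L f ->
     lipschitz (L * rho) (transition_op (glauber mu) f)) ->
  tv_dist (law (glauber mu) s t) mu <= #|V|%:R * rho ^+ t.
Proof.
move=> mu1 V0 rho0 contr.
pose f u : R := Num.sg (law (glauber mu) s t u - mu u).
have fL : lipschitz 2 f.
  move=> u w; have [->|uw] := eqVneq u w; first by rewrite subrr normr0 mulr_ge0.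
  have sg1 v : `|f v| <= 1 by rewrite normr_sg; case: (_ != 0).
  apply: le_trans (ler_normB _ _) _.
  apply: (@le_trans _ _ (1 + 1)); first exact: lerD.
  by rewrite -[leLHS]mulr1; apply: ler_wpM2l; rewrite ?addr_ge0 ?ler1n ?hamming_gt0.
have iterL k : lipschitz (2 * rho ^+ k) (iter k (transition_op (glauber mu)) f).
  elim: k => [|k IH]; first by rewrite mulr1.
  by rewrite exprSr mulrA; apply: contr => //; rewrite mulr_ge0 // exprn_ge0.
rewrite /tv_dist ler_pdivrMl //.
(* Since [mu] is stationary with mass 1, the test becomes a [mu]-average of differences of one
   iterated function, to which its Lipschitz bound applies. *)
have -> : \sum_u `|law (glauber mu) s t u - mu u| =
    \sum_w mu w * (iter t (transition_op (glauber mu)) f s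
                   - iter t (transition_op (glauber mu)) f w).
  under eq_bigr do rewrite normrEsg mulrC mulrBl.
  under [RHS]eq_bigr do rewrite mulrBr.
  rewrite !sumrB sum_law -big_distrl /= mu1 mul1r.
  by rewrite sum_stationary // => u; exact: glauber_stationary.
apply: (@le_trans _ _ (\sum_w mu w * (2 * (#|V|%:R * rho ^+ t)))); last first.
  by rewrite -big_distrl /= mu1 mul1r.
apply: ler_sum => w _.
apply: ler_wpM2l; first exact: ltW.
apply: le_trans (ler_norm _) (le_trans (iterL t s w) _).
rewrite -mulrA ler_wpM2l // mulrC ler_wpM2r ?exprn_ge0 // ler_nat.
exact: max_card.
Qed.

End Glauber.

(** * Conditional spin laws of the Ising model *)

Section Ising.
Variables (R : realType) (V : finType) (e : rel V).
Hypothesis esym : symmetric e.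
Implicit Types (x y : V) (s u : config V) (b : bool).

Lemma edge_at x (A : {set V}) :
  A \in edges e -> x \in A -> exists2 y, e x y & A = [set x; y].
Proof.
move=> /imsetP[[y z] /=]; rewrite inE /= => eyz ->.
rewrite !inE => /orP[/eqP ->|/eqP ->]; first by exists z.
by exists y; rewrite 1?esym // setUC.
Qed.

Lemma card_edges_at x : (#|[set A in edges e | x \in A]| <= degree e x)%N.
Proof.
apply: leq_trans (leq_imset_card (fun y => [set x; y]) _).
apply/subset_leq_card/subsetP => A; rewrite inE => /andP[eA xA].
by have [y exy ->] := edge_at eA xA; apply: imset_f; rewrite inE.
Qed.

(** The factor of the spin at [x] in the edge sum; without loops, each product is a single
    neighbouring spin. *)
Definition local_field x s : R :=
  \sum_(A in edges e | x \in A) \prod_(y in A | y != x) spin R (s y).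

Lemma normr_spin b : `|spin R b| = 1.
Proof. by case: b; rewrite /= ?normrN normr1. Qed.

Lemma normr_local_field x s : `|local_field x s| <= (degree e x)%:R.
Proof.
apply: le_trans (ler_norm_sum _ _ _) _.
rewrite (eq_bigr (fun=> 1%:R)) => [|A _]; last first.
  by rewrite normr_prod big1 // => y _; rewrite normr_spin.
by rewrite -natr_sum sum1dep_card ler_nat card_edges_at.
Qed.

Lemma local_field_eq x s u :
  (forall y, e x y -> s y = u y) -> local_field x s = local_field x u.
Proof.
move=> su; apply: eq_bigr => A /andP[eA xA]; apply: eq_bigr => y.
have [z exz ->] := edge_at eA xA.
by rewrite !inE => /andP[/orP[->//|/eqP ->] _]; rewrite su.
Qed.

Lemma edge_sum_set_spin x b s :
  \sum_(A in edges e) \prod_(y in A) spin R (set_spin x b s y) =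
  spin R b * local_field x s +
  \sum_(A in edges e | x \notin A) \prod_(y in A) spin R (s y).
Proof.
rewrite (bigID (fun A : {set V} => x \in A)) /= big_distrr /=; congr (_ + _).
  apply: eq_bigr => A /andP[_ xA]; rewrite (bigD1 x) //= set_spin_at.
  by congr (_ * _); apply: eq_bigr => y /andP[_ yx]; rewrite set_spin_off.
apply: eq_bigr => A /andP[_ xA]; apply: eq_bigr => y yA.
by rewrite set_spin_off //; apply: contraNneq xA => <-.
Qed.

Variables (beta : R) (h : V -> R).

Lemma ising_weight_set_spin x s :
  ising_weight e beta h (set_spin x false s) =
  ising_weight e beta h (set_spin x true s) *
  expR (- (2 * (beta * local_field x s + h x))).
Proof.
have field_sum b : \sum_y h y * spin R (set_spin x b s y) =
    h x * spin R b + \sum_(y | y != x) h y * spin R (s y).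
  rewrite (bigD1 x) //= set_spin_at; congr (_ + _).
  by apply: eq_bigr => y yx; rewrite set_spin_off.
rewrite /ising_weight -expRD !edge_sum_set_spin !field_sum /=; congr expR.
by ring.
Qed.

Lemma ising_weight_gt0 s : 0 < ising_weight e beta h s.
Proof. exact: expR_gt0. Qed.

Lemma ising_partition_gt0 : 0 < \sum_s ising_weight e beta h s.
Proof.
rewrite (bigD1 [ffun=> true]) //= ltr_pwDl ?ising_weight_gt0 //.
by apply: sumr_ge0 => s _; rewrite ltW ?ising_weight_gt0.
Qed.

Lemma ising_gt0 s : 0 < ising e beta h s.
Proof. by rewrite divr_gt0 ?ising_weight_gt0 ?ising_partition_gt0. Qed.

Lemma sum_ising : \sum_s ising e beta h s = 1.
Proof. by rewrite /ising -big_distrl /= mulfV // gt_eqF // ising_partition_gt0. Qed.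

(** The partition function and all terms away from [x] cancel, leaving a logistic function of the
    effective field. *)
Lemma plus_prob_ising x s :
  plus_prob (ising e beta h) x s =
  (1 + expR (- (2 * (beta * local_field x s + h x))))^-1.
Proof.
rewrite /plus_prob /ising -mulrDl ising_weight_set_spin.
have := ising_partition_gt0; have := ising_weight_gt0 (set_spin x true s).
have := expR_gt0 (- (2 * (beta * local_field x s + h x))).
move: (expR _) (ising_weight _ _ _ _) (\sum_u _) => E w Z E0 w0 Z0.
by field; rewrite !gt_eqF // ?addr_gt0 // mulr_gt0.
Qed.

(** This is what the logarithmic term of [h0] buys: odds of at least [D] to 1 for the favoured
    spin. *)
Lemma inv1DexpR_le (D : nat) (a : R) :
  (0 < D)%N -> ln D%:R <= 2 * a -> (1 + expR (2 * a))^-1 <= D.+1%:R^-1.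
Proof.
move=> D0 Da; rewrite lef_pV2 ?posrE ?ltr0n ?addr_gt0 ?expR_gt0 //.
by rewrite -natr1 addrC lerD2l -[leLHS]lnK ?posrE ?ltr0n // ler_expR.
Qed.

(** If no neighbour disagrees, the local fields coincide. Otherwise the count is at least 1, and
    both probabilities lie within [D.+1%:R^-1] of the same endpoint of [0, 1], chosen by the sign of
    [h x]. *)
Lemma plus_prob_ising_diff (D : nat) x s u :
  (0 < D)%N -> (degree e x <= D)%N -> h0 D beta <= `|h x| ->
  `|plus_prob (ising e beta h) x s - plus_prob (ising e beta h) x u|
  <= D.+1%:R^-1 * #|[set y | e x y & s y != u y]|%:R.
Proof.
move=> D0 xD hx.
have [/eqP|N0] := posnP #|[set y | e x y & s y != u y]|.
  rewrite cards_eq0 => /eqP N0; rewrite N0 cards0 mulr0 !plus_prob_ising.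
  rewrite (@local_field_eq x s u) ?subrr ?normr0 // => y exy.
  by apply/eqP; have := in_set0 y; rewrite -N0 inE exy => /negbFE.
apply: (@le_trans _ _ D.+1%:R^-1); last by rewrite ler_peMr ?invr_ge0 ?ler1n.
(* Neighbours can use up only the [D%:R * |beta|] part of [h0]; half of [ln D%:R] remains. *)
have bound v : `|beta * local_field x v| <= D%:R * `|beta|.
  rewrite normrM mulrC ler_wpM2r //; apply: le_trans (normr_local_field x v) _.
  by rewrite ler_nat.
have p_itv v := plus_prob_itv ising_gt0 x v.
have [hx0|hx0] := leP 0 (h x); move: hx; rewrite /h0.
  rewrite (ger0_norm hx0) => hx.
  have q v : 1 - plus_prob (ising e beta h) x v <= D.+1%:R^-1.
    have := bound v; rewrite ler_norml => /andP[bv _].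
    have -> : 1 - plus_prob (ising e beta h) x v =
        (1 + expR (2 * (beta * local_field x v + h x)))^-1.
      rewrite plus_prob_ising expRN.
      have := expR_gt0 (2 * (beta * local_field x v + h x)).
      move: (expR _) => E E0.
      by field; rewrite !gt_eqF // addr_gt0.
    by apply: inv1DexpR_le => //; lra.
  have := p_itv s; have := p_itv u; have := q s; have := q u.
  by move: (D.+1%:R^-1) => k ? ? /andP[? ?] /andP[? ?];
    rewrite ler_norml; apply/andP; split; lra.
rewrite (ltr0_norm hx0) => hx.
have q v : plus_prob (ising e beta h) x v <= D.+1%:R^-1.
  have := bound v; rewrite ler_norml => /andP[_ bv].
  by rewrite plus_prob_ising -mulrN; apply: inv1DexpR_le => //; lra.
have := p_itv s; have := p_itv u; have := q s; have := q u.
by move: (D.+1%:R^-1) => k ? ? /andP[? ?] /andP[? ?];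
    rewrite ler_norml; apply/andP; split; lra.
Qed.

End Ising.

(** * From the distance bound to the mixing time *)

Lemma mixing_time_le (R : realType) (S : finType) (P : S -> S -> R)
    (pi : S -> R) (t : nat) :
  mixed P pi t -> exists2 t', is_mixing_time P pi t' & (t' <= t)%N.
Proof.
pose m t := [forall s, tv_dist (law P s t) pi <= 4^-1].
have mP k : reflect (mixed P pi k) (m k) by exact: forallP.
move=> /mP mt; have ex : exists k, m k by exists t.
exists (ex_minn ex); case: ex_minnP => k /mP mk kmin; last exact: kmin.
by split=> // t' /mP; exact: kmin.
Qed.

Theorem theorem2p4 (R : realType) (Delta : nat) (beta : R)
    (hDelta : (2 <= Delta)%N) :
  exists2 C : R, 0 < C &
    forall (V : finType) (e : rel V) (h : V -> R),
      symmetric e -> irreflexive e ->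
      (forall x : V, (degree e x <= Delta)%N) ->
      (forall x : V, h0 Delta beta <= `|h x|) ->
      (2 <= #|V|)%N ->
      exists2 t : nat,
        is_mixing_time (glauber (ising e beta h)) (ising e beta h) t &
        t%:R <= C * (#|V|%:R * ln (#|V|%:R)).
Proof.
(* The 3 comes from [ln (4 * n) <= 3 * ln n]; the final 1 absorbs rounding the time up, as
   [n * ln n] is at least 1. *)
exists (3 * Delta.+1%:R + 1) => [|V e h esym _ edeg hh V2].
  by rewrite ltr_wpDl // mulr_ge0.
have D0 : (0 < Delta)%N by exact: ltnW.
have V0 : (0 < #|V|)%N by exact: ltnW.
set n : R := #|V|%:R; set d : R := Delta.+1%:R.
have n2 : 2 <= n by rewrite (ler_nat R 2).
have d1 : 1 <= d by rewrite ler1n.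
have n0 : 0 < n by lra.
have d0 : 0 < d by lra.
(* The contraction factor for [k = d^-1]; since [Delta%:R = d - 1], the gain is [(d * n)^-1]. *)
pose rho : R := 1 - (1 - d^-1 * Delta%:R) / n.
have rhoE : rho = 1 - (d * n)^-1.
  rewrite /rho; have -> : Delta%:R = d - 1 by rewrite /d -natr1 addrK.
  by field; rewrite !gt_eqF // ltr_pwDl.
have rho0 : 0 <= rho.
  rewrite rhoE subr_ge0 invf_le1 ?mulr_gt0 //.
  by apply: mulr_ege1 => //; lra.
have tv s t : tv_dist (law (glauber (ising e beta h)) s t) (ising e beta h)
    <= n * rho ^+ t.
  apply: glauber_tv => //; [exact: ising_gt0|exact: sum_ising|move=> L f L0 fL].
  apply: (glauber_op_lipschitz _ esym edeg) => //;
    [exact: ising_gt0|by rewrite invr_ge0 ltW|].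
  by move=> x u w; apply: plus_prob_ising_diff.
(* Apply [ln (1 + y) <= y] at [1 + y = n^-1]. *)
have lnn : 2^-1 <= ln n.
  have n'0 : 0 < n^-1 by rewrite invr_gt0.
  have n'2 : n^-1 <= 2^-1 by rewrite lef_pV2 ?posrE.
  have : ln (1 + (n^-1 - 1)) <= n^-1 - 1 by apply: le_ln1Dx; lra.
  by rewrite addrC subrK lnV ?posrE //; lra.
(* As [n] is at least 2, [4 * n] is at most [n ^+ 3]. *)
have ln4n : ln (4 * n) <= 3 * ln n.
  have -> : 3 * ln n = ln (n ^+ 3) by rewrite lnXn // mulr_natl.
  rewrite ler_ln ?posrE ?mulr_gt0 ?exprn_gt0 // exprSr ler_pM2r //.
  by rewrite expr2; nra.
(* Chosen so that [n * expR (- T / (d * n))] is at most 1/4; the successor rounds up. *)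
pose T := (Num.truncn (d * n * ln (4 * n))).+1.
have Tgt : d * n * ln (4 * n) <= T%:R by rewrite ltW // truncnS_gt.
have [|t tmix tT] := @mixing_time_le R _ (glauber (ising e beta h)) (ising e beta h) T.
  move=> s; apply: le_trans (tv s T) _.
  have : rho ^+ T <= (4 * n)^-1.
    rewrite -[leRHS]lnK ?posrE ?invr_gt0 ?mulr_gt0 // lnV ?posrE ?mulr_gt0 //.
    apply: (@le_trans _ _ (expR (- (d * n)^-1) ^+ T)).
      by rewrite lerXn2r ?nnegrE ?expR_ge0 // rhoE expR_ge1Dx.
    rewrite -expRM_natr ler_expR mulNr lerN2.
    by rewrite ler_pdivlMl ?mulr_gt0.
  rewrite -(ler_pM2l n0) => /le_trans -> //.
  by rewrite invfM mulrCA mulfV ?mulr1 // gt_eqF.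
exists t => //.
apply: (@le_trans _ _ T%:R); first by rewrite ler_nat.
rewrite -[T%:R]natr1 [leRHS]mulrDl [1 * _]mul1r; apply: lerD; last first.
  by move: (ln n) lnn => l; nra.
apply: (@le_trans _ _ (d * n * ln (4 * n))).
  by rewrite Num.Theory.truncn_le !mulr_ge0 ?ln_ge0 //; lra.
have -> : 3 * d * (n * ln n) = d * n * (3 * ln n) by ring.
by rewrite ler_wpM2l // mulr_ge0 // ltW.
Qed.
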